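(* Let $n\geq 4$ and let $(G;\{\rho_0,\ldots,\rho_{n-1}\})$ be an irreducible string C-group of rank $n$ with Schläfli type $[p_1,\ldots,p_{n-1}]$. Suppose the set $$\{\,j\in\{0,\ldots,n-3\} : \text{for all } i\in\{0,\ldots,j\},\ p_{2+i}\text{ is odd}\,\}$$ is nonempty, and let $t$ be its maximum. Then $G$ is a string C-group of rank $n-i$ for each $i\in\{0,\ldots,t\}$.
   Context: A pair $(G;\{\rho_0,\ldots,\rho_{n-1}\})$, where $G$ is a group and $\rho_0,\ldots,\rho_{n-1}$ is an ordered sequence of elements of $G$, is a string group generated by involutions (sggi) if $G=\langle\rho_0,\ldots,\rho_{n-1}\rangle$, each $\rho_i$ is an involution (an element of order exactly 2), and the commuting property holds: for all $i,j\in\{0,\ldots,n-1\}$ with $|i-j|>1$, $(\rho_i\rho_j)^2=1$. An sggi is a string C-group, of rank $n$, if it also satisfies the intersection property: for all $I,J\subseteq\{0,\ldots,n-1\}$, $\langle\rho_i\mid i\in I\rangle\cap\langle\rho_j\mid j\in J\rangle=\langle\rho_k\mid k\in I\cap J\rangle$. It is irreducible if the order of $\rho_i\rho_{i+1}$ is greater than 2 for all $0\leq i\leq n-2$. Its Schläfli type is the sequence $[p_1,\ldots,p_{n-1}]$, where $p_i$ is the order of $\rho_{i-1}\rho_i$; ''$p_i$ is odd'' means that $p_i$ is finite and odd. Saying that a group $G$ ''is a string C-group of rank $r$'' means that there exist $\sigma_0,\ldots,\sigma_{r-1}\in G$ such that $(G;\{\sigma_0,\ldots,\sigma_{r-1}\})$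 is a string C-group of rank $r$. *)

(* Defs.v *)
From mathcomp Require Import all_boot.
From mathcomp Require Import boolp classical_sets.

Set Implicit Arguments.
Unset Strict Implicit.
Unset Printing Implicit Defensive.

Local Open Scope group_scope.
Local Open Scope classical_set_scope.

Definition is_subgroup (G : groupType) (H : set G) : Prop :=
  H 1 /\ (forall x y : G, H x -> H y -> H (x / y)).

Definition generated (G : groupType) (S : set G) : set G :=
  smallest (@is_subgroup G) S.

(* Orders live in nat plus infinity: [None] stands for infinity. *)
Definition has_order (G : groupType) (x : G) (k : option nat) : Prop :=
  match k with
  | Some m => [/\ (0 < m)%N, x ^+ m = 1 &
                forall l : nat, (0 < l < m)%N -> x ^+ l <> 1]
  | None => forall l : nat, (0 < l)%N -> x ^+ l <> 1
  end.

Definition order_gt2 (k : option nat) : Prop :=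
  match k with Some m => (2 < m)%N | None => True end.

Definition order_odd (k : option nat) : Prop :=
  match k with Some m => odd m | None => False end.

Definition is_sggi (G : groupType) (n : nat) (rho : 'I_n -> G) : Prop :=
  [/\ generated (range rho) = [set: G],
      forall i : 'I_n, has_order (rho i) (Some 2) &
      forall i j : 'I_n, (i.+1 < j)%N \/ (j.+1 < i)%N ->
        (rho i * rho j) ^+ 2 = 1].

Definition intersection_property (G : groupType) (n : nat) (rho : 'I_n -> G) :
    Prop :=
  forall I J : set 'I_n,
    generated (rho @` I) `&` generated (rho @` J) = generated (rho @` (I `&` J)).

Definition is_string_Cgroup (G : groupType) (n : nat) (rho : 'I_n -> G) :
    Prop :=
  is_sggi rho /\ intersection_property rho.

Definition is_irreducible (G : groupType) (n : nat) (rho : 'I_n -> G) : Prop :=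
  forall i j : 'I_n, j = i.+1 :> nat ->
    forall k : option nat, has_order (rho i * rho j) k -> order_gt2 k.

(* [p] is indexed from 1 as in [p_1, ..., p_(n-1)]; its values outside
   {1, ..., n-1} are unconstrained. *)
Definition has_schlafli_type (G : groupType) (n : nat) (rho : 'I_n -> G)
    (p : nat -> option nat) : Prop :=
  forall i j : 'I_n, j = i.+1 :> nat -> has_order (rho i * rho j) (p j).

Definition odd_run (n : nat) (p : nat -> option nat) : set nat :=
  [set j : nat | (j <= n - 3)%N /\
                 forall i : nat, (i <= j)%N -> order_odd (p (2 + i)%N)].

Definition is_string_Cgroup_of_rank (G : groupType) (r : nat) : Prop :=
  exists sigma : 'I_r -> G, is_string_Cgroup sigma.

(* Main.v *)
Require Import Defs.
From mathcomp Require Import all_boot.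
From mathcomp Require Import boolp classical_sets.

(** The rank is lowered one unit at a time, replacing the generators
    r0, r1, r2, r3, ..., r(n-1) by r1, r0 r2, r3, ..., r(n-1).

    Suppose that r2 r3 has odd order m. As r0 is an involution commuting with
    r2 and r3, one has (r0 r2 r3)^m = r0, so r0, and with it r2, lies in
    <r0 r2, r3>: the shorter sequence s still generates the group
    ([reduce_r0], [reduce_r2]). The commutation relations are immediate.

    The intersection property is inherited because a subgroup <s_i | i in I>
    that does not contain r0 r2, or contains both r0 r2 and r3, among its
    generators is a parabolic subgroup of the old sequence, for an index set
    [lift_index I] that depends on I compatibly with intersections. In the
    remaining case, r0 r2 without r3, the subgroup is a product U V with U
    generated by r0 r2 and possibly r1, and V an old parabolic subgroup with
    indices above 3. The old intersection property makes the decomposition of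
    an element into a part in <r0, r1, r2> and a part in <r4, ...> unique
    and compatible with parabolic subgroups ([components_parabolic]), so only
    the U parts have to be compared. The single delicate point is then that
    the intersection of <r1, r0 r2> and <r0, r2> is no larger than <r0 r2>
    ([reduce_dihedral]). It holds because an involution of the dihedral group
    <r1, r0 r2> that commutes with r0 r2 is, possibly after multiplication by
    r0 r2, a rotation, and a rotation of order two commutes with r1; but
    neither r0 nor r2 commutes with r1, by irreducibility.

    Irreducibility also passes to s ([reduce_irreducible]), and the product of
    the entries 2 and 3 of s is r3 r4. Hence the reduction can be repeated as
    long as the orders p_3, p_4, ... of r2 r3, r3 r4, ... are odd, which gives
    the t reductions needed ([iter_reduce_string_Cseq]). *)

Set Implicit Arguments.
Unset Strict Implicit.
Unset Printing Implicit Defensive.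
Local Open Scope group_scope.
Local Open Scope classical_set_scope.

(** * Generated subgroups *)

Lemma generated_subgroup (G : groupType) (S : set G) :
  is_subgroup (generated S).
Proof.
split=> [A [[A1 _] _] //|x y Sx Sy A AP].
by have [[_ AF] _] := AP; apply: AF; [apply: Sx | apply: Sy].
Qed.

Lemma generated_min (G : groupType) (S H : set G) :
  is_subgroup H -> S `<=` H -> generated S `<=` H.
Proof. exact: smallest_sub. Qed.

Lemma generated1 (G : groupType) (S : set G) : generated S 1.
Proof. exact: (generated_subgroup S).1. Qed.

Lemma generatedF (G : groupType) (S : set G) (x y : G) :
  generated S x -> generated S y -> generated S (x / y).
Proof. exact: (generated_subgroup S).2. Qed.

Lemma generatedV (G : groupType) (S : set G) (x : G) :
  generated S x -> generated S x^-1.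
Proof. by rewrite -div1g; apply: generatedF; apply: generated1. Qed.

Lemma generatedM (G : groupType) (S : set G) (x y : G) :
  generated S x -> generated S y -> generated S (x * y).
Proof. by move=> Sx /generatedV Sy; rewrite -[y]invgK; apply: generatedF. Qed.

Lemma generatedX (G : groupType) (S : set G) (x : G) (m : nat) :
  generated S x -> generated S (x ^+ m).
Proof.
move=> Sx; elim: m => [|m IHm]; first exact: generated1.
by rewrite expgS; apply: generatedM.
Qed.

Lemma generatedS (G : groupType) (S T : set G) :
  S `<=` T -> generated S `<=` generated T.
Proof.
move=> ST; apply: generated_min (generated_subgroup T) _.
exact: subset_trans ST (@sub_gen_smallest _ _ _).
Qed.

Lemma centralizer_subgroup (G : groupType) (S : set G) :
  is_subgroup [set x | forall y, S y -> commute x y].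
Proof.
split=> [y _|x y cx cy z Sz]; first exact/commute_sym/commute1.
apply/commute_sym/commuteM; apply/commute_sym; first exact: cx.
exact/commute_sym/commuteV/commute_sym/cy.
Qed.

Lemma generated_commute (G : groupType) (S T : set G) :
  (forall x y, S x -> T y -> commute x y) ->
  forall x y, generated S x -> generated T y -> commute x y.
Proof.
move=> cST x y Sx Ty; apply: commute_sym; move: y Ty x Sx.
suff H : generated T `<=` [set y | forall x, generated S x -> commute y x].
  by move=> y Ty; apply: H.
apply: generated_min; first exact: centralizer_subgroup.
move=> y Ty z Sz; apply: commute_sym; move: z Sz y Ty.
apply: generated_min; first exact: centralizer_subgroup.
by move=> z Sz y; apply: cST.
Qed.

Lemma generated_prod (G : groupType) (S T : set G) (x : G) :
    (forall x y, S x -> T y -> commute x y) -> generated (S `|` T) x ->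
  exists u v, [/\ generated S u, generated T v & x = u * v].
Proof.
move=> /generated_commute cST; move: x.
suff: generated (S `|` T) `<=`
  [set x | exists u v, [/\ generated S u, generated T v & x = u * v]] by [].
apply: generated_min.
  split=> [|_ _ [u [v [Su Tv ->]]] [w [z [Sw Tz ->]]]].
    by exists 1, 1; rewrite mulg1; split=> //; apply: generated1.
  exists (u / w), (v / z); split; [exact: generatedF | exact: generatedF |].
  have cvw : commute v w^-1.
    by apply/commuteV/commute_sym/cST.
  have czw : commute w^-1 z^-1.
    by apply: cST; apply: generatedV.
  by rewrite invgM -czw -!mulgA; congr (_ * _); rewrite !mulgA cvw.
move=> x [Sx|Tx]; [exists x, 1 | exists 1, x].
  by rewrite mulg1; split=> //; [exact: sub_gen_smallest | exact: generated1].
by rewrite mul1g; split=> //; [exact: generated1 | exact: sub_gen_smallest].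
Qed.

Lemma generated_involution (G : groupType) (a x : G) :
  a * a = 1 -> generated [set a] x -> x = 1 \/ x = a.
Proof.
move=> aa; move: x; suff: generated [set a] `<=` [set x | x = 1 \/ x = a] by [].
have aV : a^-1 = a by apply: mulg1_eq.
apply: generated_min => [|_ ->]; last by right.
by split=> /= [|x y [] -> [] ->]; rewrite ?invg1 ?aV ?mulg1 ?mul1g ?aa; tauto.
Qed.

(** * Dihedral groups *)

(** Conjugation by u and inversion are both endomorphisms of the abelian
    group <c>, so they agree as soon as they agree on c. *)
Lemma dihedral_inverts (G : groupType) (c u x : G) :
    u * u = 1 -> u * c * u = c^-1 ->
  generated [set c] x -> u * x * u = x^-1.
Proof.
move=> uu ucu.
have uV : u^-1 = u by apply: mulg1_eq.
move=> Cx; suff [_ <-] : generated [set c] x /\ u * x * u = x^-1 by [].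
move: x Cx; suff: generated [set c] `<=`
  [set x | generated [set c] x /\ u * x * u = x^-1] by [].
have cC : forall x y, [set c] x -> [set c] y -> commute x y by move=> x y -> ->.
apply: generated_min => [|_ ->]; last by split=> //; apply: sub_gen_smallest.
split=> [|x y [Cx ux] [Cy uy]].
  by split; [apply: generated1 | rewrite mulg1 invg1].
split; first exact: generatedF.
have -> : u * (x / y) * u = (u * x * u) * (u * y * u)^-1.
  by rewrite !invgM uV !mulgA -[_ * u * u]mulgA uu mulg1.
rewrite ux uy invgM !invgK.
apply: (generated_commute cC) => //; exact: generatedV.
Qed.

(** Every element of <a, b> is a rotation or a rotation times b. Integer powers
    of a b are avoided: rotations are just the elements of <a b>. *)
Lemma dihedral_split (G : groupType) (a b x : G) :
    a * a = 1 -> b * b = 1 -> generated ([set a] `|` [set b]) x ->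
  generated [set a * b] x \/ generated [set a * b] (x * b).
Proof.
move=> aa bb; move: x; set C := generated [set a * b].
suff: generated ([set a] `|` [set b]) `<=` [set x | C x \/ C (x * b)] by [].
have aV : a^-1 = a by apply: mulg1_eq.
have bV : b^-1 = b by apply: mulg1_eq.
have bCb x : C x -> b * x * b = x^-1.
  apply: dihedral_inverts => //.
  by rewrite invgM aV bV !mulgA -[_ * b * b]mulgA bb mulg1.
have Cab : C (a * b) by apply: sub_gen_smallest.
apply: generated_min => [|x [] ->]; last first.
- by right; rewrite bb; apply: generated1.
- by right.
split=> [|x y]; first by left; apply: generated1.
move=> Hx [Cy|Cyb].
  have CyV := generatedV Cy.
  have ybV : y^-1 * b = b * y by rewrite -bCb // -mulgA bb mulg1.
  case: Hx => [Cx|Cxb]; first by left; apply: generatedF.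
  by right; rewrite -mulgA ybV mulgA; apply: generatedM.
case: Hx => [Cx|Cxb].
  (* y is a reflection, hence an involution: b inverts the rotation y b *)
  have yV : y^-1 = y.
    by apply: (mulgI b); rewrite -{1}bV -invgM -bCb // -!mulgA bb mulg1.
  by right; rewrite -mulgA yV; apply: generatedM.
left; suff -> : x / y = (x * b) / (y * b) by apply: generatedF.
by rewrite mulgKA.
Qed.

(** One of x and x b is a rotation; being its own inverse, it commutes with the
    reflection a, which inverts all rotations. *)
Lemma dihedral_central_involution (G : groupType) (a b x : G) :
    a * a = 1 -> b * b = 1 -> x * x = 1 -> commute x b ->
    generated ([set a] `|` [set b]) x ->
  commute a x \/ commute a (x * b).
Proof.
move=> aa bb xx xb /(dihedral_split aa bb) Hx.
have aV : a^-1 = a by apply: mulg1_eq.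
have bV : b^-1 = b by apply: mulg1_eq.
have aCa y : generated [set a * b] y -> y * y = 1 -> commute a y.
  move=> Cy yy; have yV : y^-1 = y by apply: mulg1_eq.
  have aya : a * y * a = y.
    rewrite -[RHS]yV; apply: dihedral_inverts Cy => //.
    by rewrite invgM aV bV !mulgA aa mul1g.
  by rewrite /commute -[in RHS]aya -[RHS]mulgA aa mulg1.
case: Hx => Cx; [left | right]; apply: aCa => //.
by rewrite mulgA -[x * b * x]mulgA -xb mulgA xx mul1g bb.
Qed.

(** * String C-groups indexed by the natural numbers *)

Definition parabolic (G : groupType) (r : nat -> G) (I : set nat) : set G :=
  generated (r @` I).

(** Indexing the generators by all of nat, with 1 beyond the rank, removes the
    ordinal bounds from every condition except irreducibility. Irreducibility is
    stated as non-commutation, which for involutions says that the product of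
    two neighbours has order greater than 2; it also forces every generator
    below the rank to differ from 1 as soon as the rank is at least 2. *)
Record string_Cseq (G : groupType) (n : nat) (r : nat -> G) : Prop := {
  seq_generates : forall x, parabolic r setT x;
  seq_involution : forall i, r i * r i = 1;
  seq_commute : forall i j, (i.+1 < j)%N -> commute (r i) (r j);
  seq_intersection : forall I J x,
    parabolic r I x -> parabolic r J x -> parabolic r (I `&` J) x;
  seq_irreducible : forall i, (i.+1 < n)%N -> ~ commute (r i) (r i.+1);
  seq_trivial : forall i, (n <= i)%N -> r i = 1
}.

Lemma parabolicS (G : groupType) (r : nat -> G) (I J : set nat) (x : G) :
  I `<=` J -> parabolic r I x -> parabolic r J x.
Proof. by move=> IJ; apply: generatedS; apply: image_subset. Qed.

Lemma parabolic_gen (G : groupType) (r : nat -> G) (I : set nat) (k : nat) :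
  I k -> parabolic r I (r k).
Proof. by move=> Ik; apply: sub_gen_smallest; exists k. Qed.

Lemma parabolic_min (G : groupType) (r : nat -> G) (I : set nat) (S : set G) :
  (forall k, I k -> generated S (r k)) -> parabolic r I `<=` generated S.
Proof.
by move=> IS; apply: generated_min (generated_subgroup S) _ => _ [k /IS ? <-].
Qed.

Lemma parabolic0 (G : groupType) (r : nat -> G) (x : G) :
  parabolic r set0 x -> x = 1.
Proof.
apply: (@generated_min _ _ [set 1]) => [|y [k []]//].
by split=> [//|y z -> ->]; rewrite invg1 mulg1.
Qed.

Lemma parabolic1 (G : groupType) (r : nat -> G) (k : nat) :
  parabolic r [set k] = generated [set r k].
Proof. by rewrite /parabolic image_set1. Qed.

Section Components.

Variables (G : groupType) (n : nat) (r : nat -> G).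
Hypothesis rC : string_Cseq n r.

(* The index 3 belongs to neither set, so that the generators indexed by the
   first commute with those indexed by the second. *)
Let low : set nat := [set k | (k < 3)%N].
Let high : set nat := [set k | (3 < k)%N].

Lemma parabolic_prod (A B : set nat) (x : G) :
    A `<=` low -> B `<=` high -> parabolic r (A `|` B) x ->
  exists u v, [/\ parabolic r A u, parabolic r B v & x = u * v].
Proof.
move=> Alow Bhigh; rewrite /parabolic image_setU.
apply: generated_prod => _ _ [i Ai <-] [j Bj <-].
apply: (seq_commute rC).
exact: leq_ltn_trans (Alow _ Ai) (Bhigh _ Bj).
Qed.

Lemma parabolic_disjoint (I J : set nat) (x : G) :
    parabolic r I x -> parabolic r J x -> (forall k, I k -> J k -> False) ->
  x = 1.
Proof.
move=> Ix Jx IJ; apply: (@parabolic0 _ r).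
by apply: parabolicS (seq_intersection rC Ix Jx) => k [] /IJ.
Qed.

(** The intersection of <r0, r1, r2> and <r4, ...> is generated by the empty
    family. *)
Lemma prod_unique (u v u' v' : G) :
    parabolic r low u -> parabolic r high v ->
    parabolic r low u' -> parabolic r high v' ->
  u * v = u' * v' -> u = u' /\ v = v'.
Proof.
move=> Lu Hv Lu' Hv' uv.
have uE : u'^-1 * u = v' / v.
  by apply: (mulgI u'); rewrite mulVKg mulgA -uv mulgK.
have u1 : u'^-1 * u = 1.
  apply: (@parabolic_disjoint low high) => [||k]; last 1 first.
  - by rewrite /low /high /= => k3; rewrite ltnNge ltnW.
  - by apply: generatedM => //; apply: generatedV.
  - by rewrite uE; apply: generatedF.
split; first by apply: (mulgI u'^-1); rewrite u1 mulVg.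
by apply/esym/divg1_eq; rewrite -uE.
Qed.

(** The intersection property puts u v in the parabolic subgroup of the indices
    of J that are low or in K. That subgroup is itself a product of a low and
    a high part, and the decomposition is unique. *)
Lemma components_parabolic (K J : set nat) (u v : G) :
    K `<=` high -> parabolic r low u -> parabolic r K v ->
    parabolic r J (u * v) ->
  parabolic r (low `&` J) u /\ parabolic r (K `&` J) v.
Proof.
move=> Khigh Lu Kv Juv.
have LKuv : parabolic r (low `|` K) (u * v).
  by apply: generatedM; [move: Lu | move: Kv]; apply: parabolicS => k;
    [left | right].
have := seq_intersection rC LKuv Juv; rewrite setIUl => H.
have [||u' [v' [Lu' Kv' uv]]] := parabolic_prod _ _ H.
- by move=> k [].
- by move=> k [/Khigh].
have [-> ->] // : u = u' /\ v = v'.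
apply: prod_unique uv => //; first exact: parabolicS Kv.
  by apply: parabolicS Lu' => k [].
by apply: parabolicS Kv' => k [/Khigh].
Qed.

End Components.

(** * Rank reduction *)

Definition reduce (G : groupType) (r : nat -> G) (k : nat) : G :=
  match k with 0 => r 1%N | 1%N => r 0 * r 2 | k'.+2 => r k'.+3 end.

(** The largest set of old generators visibly contained in the subgroup generated
    by the new ones with index in I. Both r0 and r2 require r0 r2 and r3, that
    is, the new indices 1 and 2. *)
Definition lift_index (I : set nat) : set nat := [set k |
  match k with 0 => I 1%N /\ I 2
  | 1%N => I 0
  | 2 => I 1%N /\ I 2
  | k'.+3 => I k'.+2
  end].

Section Reduction.

Variables (G : groupType) (n : nat) (r : nat -> G) (m : nat).
Hypotheses (rC : string_Cseq n r) (n_gt3 : (3 < n)%N).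
Hypotheses (m_odd : odd m) (r23m : (r 2 * r 3) ^+ m = 1).

Let s := reduce r.
Let low : set nat := [set k | (k < 3)%N].
Let high : set nat := [set k | (3 < k)%N].

Let rr i : r i * r i = 1 := seq_involution rC i.
Let c02 : commute (r 0) (r 2). Proof. exact: (seq_commute rC). Qed.
Let c03 : commute (r 0) (r 3). Proof. exact: (seq_commute rC). Qed.

Lemma reduce_involution k : s k * s k = 1.
Proof.
case: k => [|[|k]] /=; rewrite ?rr //.
by rewrite mulgA -[_ * r 2 * r 0]mulgA -c02 mulgA rr mul1g rr.
Qed.

Lemma odd_expg_involution (x : G) : x * x = 1 -> x ^+ m = x.
Proof.
move=> xx; rewrite -(odd_double_half m) m_odd -mul2n expgnDr expgnA.
by rewrite expg1 [x ^+ 2]xx expg1n mulg1.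
Qed.

(** As r0 commutes with r2 r3, the m-th power of (r0 r2) r3 is r0^m (r2 r3)^m, and
    m is odd. *)
Lemma reduce_r0 (I : set nat) : I 1%N -> I 2%N -> parabolic s I (r 0).
Proof.
move=> I1 I2; have -> : r 0 = (s 1%N * s 2) ^+ m.
  rewrite /= -mulgA expgMn; last exact: commuteM.
  by rewrite r23m mulg1 odd_expg_involution.
by apply: generatedX; apply: generatedM; apply: parabolic_gen.
Qed.

Lemma reduce_r2 (I : set nat) : I 1%N -> I 2%N -> parabolic s I (r 2).
Proof.
move=> I1 I2; have -> : r 2 = r 0 * s 1%N by rewrite /= mulgA rr mul1g.
by apply: generatedM; [exact: reduce_r0 | exact: parabolic_gen].
Qed.

Lemma lift_index_sub (I : set nat) :
  parabolic r (lift_index I) `<=` parabolic s I.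
Proof.
apply: parabolic_min => -[|[|[|k]]] /=.
- by case; apply: reduce_r0.
- by move=> I0; apply: (@parabolic_gen _ s I 0).
- by case; apply: reduce_r2.
- by move=> Ik; apply: (@parabolic_gen _ s I k.+2).
Qed.

(** When I contains 1 but not 2 this fails: the product r0 r2 is available while
    r0 and r2 separately are not. *)
Lemma lift_index_sup (I : set nat) :
  (I 1%N -> I 2%N) -> parabolic s I `<=` parabolic r (lift_index I).
Proof.
move=> I12; apply: parabolic_min => -[|[|k]] Ik /=.
- exact: parabolic_gen.
- by apply: generatedM; apply: parabolic_gen; split=> //; apply: I12.
- exact: parabolic_gen.
Qed.

Lemma lift_indexI (I J : set nat) :
  lift_index I `&` lift_index J `<=` lift_index (I `&` J).
Proof. by move=> [|[|[|k]]] /= []; tauto. Qed.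

(** Without r3 the new generators fall into two commuting families. *)
Lemma reduce_split (I : set nat) (x : G) :
    ~ I 2%N -> parabolic s I x ->
  exists u v, [/\ parabolic s (I `&` [set k | (k < 2)%N]) u,
                  parabolic r (lift_index I `&` high) v & x = u * v].
Proof.
move=> I2; pose L := [set k | (k < 2)%N]; pose U := [set k | (2 < k)%N].
move=> Ix; have {}Ix : parabolic s (I `&` L `|` I `&` U) x.
  by apply: parabolicS Ix => -[|[|[|k]]] Ik; [left | left | | right].
rewrite /parabolic image_setU in Ix.
have [|u [v [Lu Uv ->]]] := generated_prod _ Ix.
  move=> _ _ [i [_ Li] <-] [[|[|[|j]]] [_ //] _ <-]; case: i Li => [|[|i]] //= _.
    exact: (seq_commute rC).
  apply/commute_sym; apply: commuteM; apply/commute_sym; exact: (seq_commute rC).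
exists u, v; split=> //; apply: parabolic_min Uv => -[|[|[|k]]] [Ik] //= _.
exact: parabolic_gen.
Qed.

Lemma reduce_low (I : set nat) (u : G) :
    parabolic s (I `&` [set k | (k < 2)%N]) u ->
  parabolic r [set k | k = 0%N \/ k = 2%N \/ (k = 1%N /\ I 0%N)] u.
Proof.
apply: parabolic_min => -[|[|k]] [Ik] //= _.
  by apply: parabolic_gen => /=; tauto.
by apply: generatedM; apply: parabolic_gen => /=; tauto.
Qed.

Lemma reduce_low_high (I : set nat) (u : G) :
  parabolic s (I `&` [set k | (k < 2)%N]) u -> parabolic r low u.
Proof.
move=> /reduce_low; apply: parabolicS => k /=.
by case=> [->|[->|[-> _]]].
Qed.

(** The elements of <r0, r2> are 1, r0, r2 and r0 r2. If r0 or r2 belonged to the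
    dihedral group <r1, r0 r2>, then by [dihedral_central_involution] r1 would
    commute with r0 or with r2, against irreducibility. *)
Lemma reduce_dihedral (u : G) :
    parabolic s [set k | (k < 2)%N] u ->
    parabolic r [set k | k = 0%N \/ k = 2%N] u ->
  parabolic s [set 1%N] u.
Proof.
have s11 : r 0 * r 2 * (r 0 * r 2) = 1 by exact: (reduce_involution 1%N).
have sE : [set k | (k < 2)%N] = [set 0%N] `|` [set 1%N].
  apply/seteqP; split=> [[|[|k]]|k] //=; [by left | by right |].
  by case=> ->.
rewrite sE /parabolic image_setU !image_set1 /= => Du.
have r0s : commute (r 0) (r 0 * r 2) by apply: commuteM.
have r2s : commute (r 2) (r 0 * r 2).
  by apply: commuteM => //; apply: commute_sym.
have Nr1r0 : ~ commute (r 1%N) (r 0).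
  by move/commute_sym; apply: (seq_irreducible rC); apply: ltn_trans n_gt3.
have Nr1r2 : ~ commute (r 1%N) (r 2).
  by apply: (seq_irreducible rC); apply: ltn_trans n_gt3.
have r0D : ~ generated ([set r 1%N] `|` [set r 0 * r 2]) (r 0).
  move/(dihedral_central_involution (rr 1%N) s11 (rr 0) r0s).
  by rewrite mulgA rr mul1g => -[].
have r2D : ~ generated ([set r 1%N] `|` [set r 0 * r 2]) (r 2).
  move/(dihedral_central_involution (rr 1%N) s11 (rr 2) r2s).
  by rewrite c02 mulgA rr mul1g => -[].
have -> : [set k | k = 0%N \/ k = 2%N] = [set 0%N] `|` [set 2%N].
  by apply/seteqP; split.
rewrite image_setU !image_set1 => Eu.
have [|v [w [Ev Ew uE]]] := generated_prod _ Eu; first by move=> _ _ -> ->.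
move: Du; rewrite uE.
have [-> | ->] := generated_involution (rr 0) Ev;
have [-> | ->] := generated_involution (rr 2) Ew.
- by rewrite mulg1 => _; apply: generated1.
- by rewrite mul1g => /r2D.
- by rewrite mulg1 => /r0D.
- by move=> _; apply: sub_gen_smallest.
Qed.

(** Here [I] is the exceptional case and [J] gives an old parabolic subgroup. When
    J contains 0 and 1, it contains all the generators of the U part. When it
    lacks 1, the old intersection property suffices. When it contains 1 but not
    0, the two subgroups to intersect lie in <r1, r0 r2> and <r0, r2>. *)
Lemma reduce_intersection_low (I J : set nat) (u : G) :
    I 1%N -> ~ I 2%N -> (J 1%N -> J 2%N) ->
    parabolic s (I `&` [set k | (k < 2)%N]) u ->
    parabolic r (low `&` lift_index J) u ->
  parabolic s (I `&` J) u.
Proof.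
move=> I1 I2 J12 Iu Ju.
have [J1|J1] := pselect (J 1%N); last first.
  have := seq_intersection rC (reduce_low Iu) Ju => Hu.
  apply: lift_index_sub; apply: parabolicS Hu.
  move=> [|[|[|k]]] [Ik [k_lt3 Jk]]; rewrite /lift_index //=.
  - by case: Jk.
  - by case: Ik => [//|[//|[_ I0]]].
  - by case: Jk.
have [J0|J0] := pselect (J 0%N).
  by apply: parabolicS Iu => -[|[|k]] [].
have Hu : parabolic s [set 1%N] u.
  apply: reduce_dihedral; first by apply: parabolicS Iu => k [].
  by apply: parabolicS Ju => -[|[|[|k]]] /= []; auto.
by apply: parabolicS Hu => k ->.
Qed.

Lemma reduce_intersection_mixed (I J : set nat) (x : G) :
    I 1%N -> ~ I 2%N -> (J 1%N -> J 2%N) ->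
    parabolic s I x -> parabolic s J x ->
  parabolic s (I `&` J) x.
Proof.
move=> I1 I2 J12 Ix /(lift_index_sup J12) Jx.
have [u [v [Iu Iv xE]]] := reduce_split I2 Ix; rewrite xE in Jx *.
have Hhigh : lift_index I `&` high `<=` high by move=> k [].
have [Ju Jv] := components_parabolic rC Hhigh (reduce_low_high Iu) Iv Jx.
apply: generatedM; first exact: reduce_intersection_low.
apply: lift_index_sub; apply: parabolicS Jv => k [[Ik _] Jk].
exact: lift_indexI.
Qed.

Lemma reduce_intersection (I J : set nat) (x : G) :
  parabolic s I x -> parabolic s J x -> parabolic s (I `&` J) x.
Proof.
move=> Ix Jx.
have [I12|I12] := pselect (I 1%N -> I 2%N).
  have [J12|J12] := pselect (J 1%N -> J 2%N).
    have := seq_intersection rC (lift_index_sup I12 Ix) (lift_index_sup J12 Jx).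
    move=> Hx; apply: lift_index_sub.
    by apply: parabolicS Hx; apply: lift_indexI.
  have [J1 J2] : J 1%N /\ ~ J 2%N by apply/not_implyP.
  by rewrite setIC; apply: reduce_intersection_mixed.
have [I1 I2] : I 1%N /\ ~ I 2%N by apply/not_implyP.
have [J12|J12] := pselect (J 1%N -> J 2%N).
  exact: reduce_intersection_mixed.
have [J1 J2] : J 1%N /\ ~ J 2%N by apply/not_implyP.
have [u [v [Iu Iv xE]]] := reduce_split I2 Ix.
have [u' [v' [Ju Jv xE']]] := reduce_split J2 Jx.
have [uE vE] : u = u' /\ v = v'.
  apply: (prod_unique rC); [exact: reduce_low_high Iu | | | | by rewrite -xE].
  - by apply: parabolicS Iv => k [].
  - exact: reduce_low_high Ju.
  - by apply: parabolicS Jv => k [].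
subst u' v'; rewrite xE; apply: generatedM.
  (* both index sets contain 1, so their parts below 2 are nested *)
  have [I0|I0] := pselect (I 0%N).
    by apply: parabolicS Ju => -[|[|k]] [].
  by apply: parabolicS Iu => -[|[|k]] [].
apply: lift_index_sub; apply: parabolicS (seq_intersection rC Iv Jv).
by move=> k [[Ik _] [Jk _]]; apply: lift_indexI.
Qed.

(** Only the first two products of neighbours are new: r1 r0 r2 is treated by the
    intersection property; if r0 r2 commuted with r3, then so would r2, since
    r0 does. *)
Lemma reduce_irreducible i : (i.+1 < n.-1)%N -> ~ commute (s i) (s i.+1).
Proof.
case: i => [|[|i]] /= i_lt.
- have r12 : r 1%N <> 1.
    move=> r1; apply: (@seq_irreducible _ _ _ rC 0); first exact: ltn_trans n_gt3.
    by rewrite r1; apply: commute1.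
  (* If r1 commuted with r0 r2, the conjugates of r1 by r0 and by r2 would
     coincide and lie in <r0, r1> and <r1, r2>, hence in <r1> = {1, r1}; so r0
     would commute with r1. *)
  move=> c; pose x := r 0 * r 1%N * r 0.
  have xE : x = r 2 * r 1%N * r 2.
    apply: (mulgI (r 0)); rewrite /x !mulgA rr mul1g.
    apply: (mulIg (r 2)); rewrite -[_ * r 2 * r 2]mulgA rr mulg1.
    by rewrite -c -mulgA.
  have : parabolic r ([set k | (k < 2)%N] `&` [set k | (0 < k < 3)%N]) x.
    apply: (seq_intersection rC); last rewrite xE;
    by apply: generatedM; [apply: generatedM|]; apply: parabolic_gen.
  move=> Hx; have {}Hx : parabolic r [set 1%N] x.
    by apply: parabolicS Hx => -[|[|k]] [].
  rewrite parabolic1 in Hx.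
  have x01 : x * r 0 = r 0 * r 1%N by rewrite /x -mulgA rr mulg1.
  case: (generated_involution (rr 1%N) Hx) => x1; rewrite x1 in x01.
    by apply: r12; apply: (mulgI (r 0)); rewrite -x01 mul1g mulg1.
  by apply: (@seq_irreducible _ _ _ rC 0) => //; apply: ltn_trans n_gt3.
- move=> c; apply: (@seq_irreducible _ _ _ rC 2) => //.
  have -> : r 2 = r 0 * (r 0 * r 2) by rewrite mulgA rr mul1g.
  by apply/commute_sym/commuteM; apply/commute_sym.
- apply: (seq_irreducible rC).
  by rewrite -(ltn_predK n_gt3) ltnS.
Qed.

Lemma reduce_string_Cseq : string_Cseq n.-1 s.
Proof.
split.
- move=> x; apply: lift_index_sub.
  by apply: parabolicS (seq_generates rC x) => -[|[|[|k]]].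
- exact: reduce_involution.
- move=> [|[|i]] [|[|[|j]]] //= ij; try exact: (seq_commute rC).
  by apply/commute_sym/commuteM; apply/commute_sym; apply: (seq_commute rC).
- exact: reduce_intersection.
- exact: reduce_irreducible.
- move=> k; rewrite -ltnS (ltn_predK n_gt3) => nk.
  have := leq_trans n_gt3 nk; case: k nk => [|[|k]] //= nk _.
  exact: (seq_trivial rC).
Qed.

End Reduction.

(** * Iterated reduction *)

(** After j reductions the entries from index 2 on are those of r shifted by j, so
    the product of entries 2 and 3 that has to be of odd order at the next
    reduction is r(j+2) r(j+3). *)
Lemma iter_reduce_string_Cseq (G : groupType) (n t : nat) (r : nat -> G) :
    string_Cseq n r -> (t.+2 < n)%N ->
    (forall k, (0 < k <= t)%N ->
       exists2 m, odd m & (r k.+1 * r k.+2) ^+ m = 1) ->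
  forall i, (i <= t)%N -> string_Cseq (n - i) (iter i (@reduce G) r).
Proof.
move=> rC tn r_odd; elim=> [|i IHi] it; first by rewrite subn0.
have [m m_odd rm] := r_odd i.+1 it.
have iterE j k : iter j (@reduce G) r k.+2 = r (j + k.+2)%N.
  by elim: j k => [//|j IHj] k; rewrite iterS /= IHj addSnnS.
rewrite subnS iterS; apply: (reduce_string_Cseq (IHi (ltnW it)) _ m_odd).
  by rewrite ltn_subRL addnC; apply: leq_ltn_trans tn; rewrite !addSn !ltnS.
by rewrite !iterE !addnS addn0.
Qed.

(** * Sequences on ordinals *)

Definition extend (G : groupType) (n : nat) (rho : 'I_n -> G) (k : nat) : G :=
  if insub k is Some i then rho i else 1.

Lemma extend_ord (G : groupType) (n : nat) (rho : 'I_n -> G) (i : 'I_n) :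
  extend rho i = rho i.
Proof. by rewrite /extend valK. Qed.

Lemma extend_out (G : groupType) (n : nat) (rho : 'I_n -> G) (k : nat) :
  (n <= k)%N -> extend rho k = 1.
Proof. by move=> nk; rewrite /extend insubF // ltnNge nk. Qed.

Lemma parabolic_extend (G : groupType) (n : nat) (rho : 'I_n -> G) I :
  parabolic (extend rho) I = generated (rho @` [set i : 'I_n | I i]).
Proof.
apply/seteqP; split.
  apply: parabolic_min => k Ik; have [kn|nk] := ltnP k n.
    rewrite -[k]/(val (Ordinal kn)) extend_ord; apply: sub_gen_smallest.
    by exists (Ordinal kn).
  by rewrite extend_out //; apply: generated1.
apply: generatedS => _ [i Ii <-]; exists (i : nat) => //; exact: extend_ord.
Qed.

Lemma string_Cgroup_extend (G : groupType) (n : nat) (rho : 'I_n -> G) :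
    is_string_Cgroup rho ->
    (forall i j : 'I_n, j = i.+1 :> nat -> (rho i * rho j) ^+ 2 <> 1) ->
  string_Cseq n (extend rho).
Proof.
move=> [[rho_gen rho2 rho_comm] rho_IP] rho_irr.
have rr k : extend rho k * extend rho k = 1.
  have [kn|nk] := ltnP k n; last by rewrite extend_out // mulg1.
  rewrite -[k]/(val (Ordinal kn)) extend_ord.
  by have [_] := rho2 (Ordinal kn); rewrite expg2.
split=> //.
- by move=> x; rewrite parabolic_extend; have : [set: G] x by []; rewrite -rho_gen.
- move=> i j ij; have [jn|nj] := ltnP j n; last first.
    by rewrite [extend rho j]extend_out //; apply: commute1.
  have i_n : (i < n)%N by apply: ltn_trans jn; apply: ltnW.
  have := rho_comm (Ordinal i_n) (Ordinal jn) (or_introl ij).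
  have rV k : (extend rho k)^-1 = extend rho k by apply: mulg1_eq.
  rewrite -!extend_ord /= expg2 => /mulg1_eq.
  by rewrite invgM !rV => /esym.
- by move=> I J x; rewrite !parabolic_extend => Ix Jx; rewrite -rho_IP.
- move=> i i_lt c; apply: (rho_irr (Ordinal (ltnW i_lt)) (Ordinal i_lt)) => //.
  by rewrite -!extend_ord expgMn //= !expg2 !rr mulg1.
- exact: extend_out.
Qed.

Lemma string_Cseq_group (G : groupType) (n : nat) (r : nat -> G) :
  (1 < n)%N -> string_Cseq n r -> is_string_Cgroup_of_rank G n.
Proof.
move=> n_gt1 rC; exists (fun i : 'I_n => r i).
have genE (I : set 'I_n) :
    generated ((fun i : 'I_n => r i) @` I) = parabolic r (@nat_of_ord n @` I).
  by rewrite /parabolic image_comp.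
have r1 k : (k < n)%N -> r k <> 1.
  case: k => [|k] kn rk1.
    by apply: (@seq_irreducible _ _ _ rC 0 n_gt1); rewrite rk1;
      apply/commute_sym/commute1.
  by apply: (@seq_irreducible _ _ _ rC k kn); rewrite rk1; apply: commute1.
split; first split.
- apply/seteqP; split=> // x _; rewrite genE.
  apply: parabolic_min (seq_generates rC x) => k _; have [kn|nk] := ltnP k n.
    by apply: parabolic_gen; exists (Ordinal kn).
  by rewrite (seq_trivial rC nk); apply: generated1.
- move=> i; split=> //; first by rewrite expg2 (seq_involution rC).
  by move=> [|[|l]] //= _; rewrite expg1; apply: r1.
- move=> i j ij; have c : commute (r i) (r j).
    by case: ij => ij; [|apply: commute_sym]; apply: (seq_commute rC).
  by rewrite expgMn // !expg2 !(seq_involution rC) mulg1.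
move=> I J; apply/seteqP; split=> x.
  rewrite !genE => -[Ix Jx]; apply: parabolicS (seq_intersection rC Ix Jx).
  by move=> _ [[i Ii <-] [j Jj /val_inj ji]]; exists i => //; rewrite -ji in Ii *.
by move=> IJx; split; apply: generatedS IJx => _ [i [Ii Ji] <-]; exists i.
Qed.

Lemma has_order_gt2 (G : groupType) (x : G) (k : option nat) :
  has_order x k -> order_gt2 k -> x ^+ 2 <> 1.
Proof. by case: k => [m|] /= => [[_ _ xm] m2 | xm _]; apply: xm. Qed.

Unset Implicit Arguments.

Theorem corollary1p3 (n : nat) (hn : (4 <= n)%N) (G : groupType)
    (rho : 'I_n -> G) (p : nat -> option nat)
    (rhoC : is_string_Cgroup rho)
    (rho_irr : is_irreducible rho)
    (rho_type : has_schlafli_type rho p)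
    (run_neq0 : odd_run n p !=set0)
    (t : nat) (run_t : odd_run n p t)
    (t_max : forall j : nat, odd_run n p j -> (j <= t)%N) :
  forall i : nat, (i <= t)%N -> is_string_Cgroup_of_rank G (n - i)%N.
Proof.
move=> i it; have [tn p_odd] := run_t.
have t2n : (t.+2 < n)%N.
  by rewrite -(subnK (ltnW hn)) -[t.+2]addn2 [(_ + 3)%N]addnS ltnS leq_add2r.
apply: (@string_Cseq_group G _ (iter i (@reduce G) (extend rho))).
  by rewrite ltn_subRL addn1; apply: leq_ltn_trans t2n; rewrite ltnW.
apply: (@iter_reduce_string_Cseq _ n t) => //.
  apply: string_Cgroup_extend => // j k kj.
  have kp := rho_type _ _ kj.
  exact: has_order_gt2 kp (rho_irr _ _ kj _ kp).
move=> k /andP [_ kt].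
have k2n : (k.+2 < n)%N by apply: leq_ltn_trans t2n.
have := rho_type (Ordinal (ltnW k2n)) (Ordinal k2n) erefl.
have := p_odd k kt; rewrite -!extend_ord /= add2n.
by case: (p k.+2) => // m m_odd [_ rm _]; exists m.
Qed.
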